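(* Let $\circledast$ and $\odot$ be proper multiplications on $\mathbb{Z}^d$ with $\odot\notin\{\circledast,\circledast_{\mathrm{op}}\}$. There exists $A\subseteq\mathbb{Z}^d_{\neq0}$ which is $\mathrm{IP}$ in the semigroup $(\mathbb{Z}^d_{\neq0},\circledast)$ but not $\mathrm{IP}_2$ in the semigroup $(\mathbb{Z}^d_{\neq0},\odot)$.
   Context: A proper multiplication on $\mathbb{Z}^d$ is a binary operation $\circledast:\mathbb{Z}^d\times\mathbb{Z}^d\to\mathbb{Z}^d$ making $(\mathbb{Z}^d,+)$ an associative (not necessarily commutative or unital) ring without zero divisors; $\mathbb{Z}^d_{\neq0}=\mathbb{Z}^d\setminus\{0\}$; $x\circledast_{\mathrm{op}}y=y\circledast x$. In a semigroup $(S,\cdot)$: $A$ is $\mathrm{IP}_r$ if there are $s_1,\dots,s_r\in S$ such that $A$ contains all products $s_{i_1}\cdots s_{i_k}$ with $1\le k\le r$, $i_1<\dots<i_k$ in $\{1,\dots,r\}$; $A$ is $\mathrm{IP}$ if there is a sequence $(s_i)_{i\in\mathbb{N}}$ in $S$ such that $A$ contains all products $s_{i_1}\cdots s_{i_k}$ with $k\ge1$ and $i_1<\dots<i_k$ in $\mathbb{N}$. *)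

(* Defs.v *)
From mathcomp Require Import all_boot all_order all_algebra.
From mathcomp Require Import boolp classical_sets.

Set Implicit Arguments.
Unset Strict Implicit.
Unset Printing Implicit Defensive.

Import GRing.Theory.
Local Open Scope classical_set_scope.
Local Open Scope ring_scope.

(* The products s_(i_1) ... s_(i_k) with k >= 1 and i_1 < ... < i_k, taken in
   that order: i = i_1 and l = [:: i_2; ...; i_k], so that no unit is needed. *)
Definition ordered_products (I T : Type) (lt : rel I) (op : T -> T -> T)
    (s : I -> T) : set T :=
  [set x | exists (i : I) (l : seq I),
     path lt i l /\ x = foldl op (s i) (map s l)].

(* A is IP_r in the semigroup with carrier S (a subset of T closed under op). *)
Definition is_IPr (r : nat) (T : Type) (S : set T) (op : T -> T -> T)
    (A : set T) : Prop :=
  exists s : 'I_r -> T,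
    (forall i, S (s i)) /\
    ordered_products (fun i j : 'I_r => (i < j)%N) op s `<=` A.

Definition is_IP (T : Type) (S : set T) (op : T -> T -> T) (A : set T) : Prop :=
  exists s : nat -> T,
    (forall i, S (s i)) /\ ordered_products ltn op s `<=` A.

Definition proper_mul (d : nat)
    (mul : 'rV[int]_d -> 'rV[int]_d -> 'rV[int]_d) : Prop :=
  [/\ associative mul,
      left_distributive mul +%R,
      right_distributive mul +%R &
      forall x y, mul x y = 0 -> x = 0 \/ y = 0].

Definition op_mul (T : Type) (mul : T -> T -> T) : T -> T -> T :=
  fun x y => mul y x.

Definition nonzero_vec (d : nat) : set 'rV[int]_d := [set x | x <> 0].
Arguments nonzero_vec d : clear implicits.

Lemma nonzero_vec_closed (d : nat)
    (mul : 'rV[int]_d -> 'rV[int]_d -> 'rV[int]_d) (x y : 'rV[int]_d) :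
  proper_mul mul -> nonzero_vec d x -> nonzero_vec d y ->
  nonzero_vec d (mul x y).
Proof. by move=> [_ _ _ nzd] x0 y0 /nzd[]. Qed.

(* Main.v *)
Require Import Defs.
From mathcomp Require Import all_boot all_order all_algebra.
From mathcomp Require Import boolp classical_sets.

Set Implicit Arguments.
Unset Strict Implicit.
Unset Printing Implicit Defensive.

Local Open Scope classical_set_scope.
Local Open Scope ring_scope.

Import Order.TTheory GRing.Theory Num.Theory.

(* Choose the sequence s_0, s_1, ... greedily, each s_n being generic.  Let P be
   the finite set of ordered products chosen so far (for mul1, with the empty
   product 1 of the rational algebra included).  A new s turns a product p into
   p s, so each relation x o y = z to be avoided (o = mul2) becomes an equation
   between homogeneous polynomials in s.  If the degrees differ, it fails for
   generic s.  Otherwise it reads (p s) o y = r s or y o (p s) = r s, and one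
   needs that these are not identities in s.  Preserving this for the next step
   reduces, again by degree, to (p x) o (q t) = r t x and (q t) o (p x) = r t x
   not being identities in x and t; by specialising s = 1 these persist, and for
   p = q = r = 1 they are the hypotheses that mul2 is neither the opposite of
   mul1 nor mul1 itself. *)

(** * Functions polynomial along lines *)

(* Being polynomial along every line is weaker than being polynomial, but it is
   all that genericity needs. *)
Definition line_poly (d : nat) (f : 'rV[int]_d -> int) : Prop :=
  forall a b, exists p : {poly int}, forall t : int, f (a + t *: b) = p.[t].

Lemma line_poly_cst (d : nat) (c : int) : line_poly (fun _ : 'rV[int]_d => c).
Proof. by move=> a b; exists c%:P => t; rewrite hornerC. Qed.

Lemma line_poly_coord (d : nat) (j : 'I_d) :
  line_poly (fun s : 'rV[int]_d => s 0 j).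
Proof.
move=> a b; exists ((a 0 j)%:P + (b 0 j) *: 'X) => t.
by rewrite !hornerE !mxE mulrC.
Qed.

Lemma line_polyD (d : nat) (f g : 'rV[int]_d -> int) :
  line_poly f -> line_poly g -> line_poly (fun s => f s + g s).
Proof.
move=> hf hg a b; have [p hp] := hf a b; have [q hq] := hg a b.
by exists (p + q) => t; rewrite hornerD hp hq.
Qed.

Lemma line_polyM (d : nat) (f g : 'rV[int]_d -> int) :
  line_poly f -> line_poly g -> line_poly (fun s => f s * g s).
Proof.
move=> hf hg a b; have [p hp] := hf a b; have [q hq] := hg a b.
by exists (p * q) => t; rewrite hornerM hp hq.
Qed.

Lemma line_poly_sum (d n : nat) (f : 'I_n -> 'rV[int]_d -> int) :
  (forall i, line_poly (f i)) -> line_poly (fun s => \sum_i f i s).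
Proof.
move=> hf a b; have [p hp] := choice (fun i => hf i a b).
by exists (\sum_i p i) => t; rewrite horner_sum; apply: eq_bigr.
Qed.

(** The integers 0, ..., [size p] - 1 are one too many to be all roots of [p]. *)
Lemma poly_int_nonroot (p : {poly int}) : p != 0 -> exists t : int, p.[t] != 0.
Proof.
move=> p0; pose rs := [seq n%:Z | n <- iota 0 (size p)].
have urs : uniq rs by rewrite map_inj_uniq ?iota_uniq // => x y [].
have : ~~ all (root p) rs.
  by apply/negP => /(max_poly_roots p0)/(_ urs); rewrite size_map size_iota ltnn.
by case/allPn => t _ ht; exists t.
Qed.

(** * Generic properties *)

(** Plays the role of containing a nonempty Zariski open set. One function suffices for finitely
    many conditions, since functions can be multiplied. *)
Definition generically (d : nat) (B : 'rV[int]_d -> Prop) : Prop :=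
  exists f : 'rV[int]_d -> int,
    [/\ line_poly f, exists s, f s != 0 & forall s, f s != 0 -> B s].

Lemma generically_ex (d : nat) (B : 'rV[int]_d -> Prop) :
  generically B -> exists s, B s.
Proof. by case=> f [_ [s fs] /(_ s fs) Bs]; exists s. Qed.

Lemma generically_sub (d : nat) (B B' : 'rV[int]_d -> Prop) :
  (forall s, B s -> B' s) -> generically B -> generically B'.
Proof. by move=> BB' [f [lf ex fB]]; exists f; split=> // s /fB/BB'. Qed.

Lemma generically_true (d : nat) (B : 'rV[int]_d -> Prop) :
  (forall s, B s) -> generically B.
Proof.
by move=> hB; exists (fun=> 1); split=> //; [exact: line_poly_cst | exists 0].
Qed.

(* Neither polynomial function vanishes identically on the line joining the two
   witnesses. *)
Lemma generically_and (d : nat) (B B' : 'rV[int]_d -> Prop) :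
  generically B -> generically B' -> generically (fun s => B s /\ B' s).
Proof.
move=> [f [lf [a fa] fB]] [g [lg [b gb] gB]].
exists (fun s => f s * g s); split; first exact: line_polyM.
- have [p hp] := lf a (b - a); have [q hq] := lg a (b - a).
  have p0 : p != 0.
    apply: contraNneq fa => p0.
    by have := hp 0; rewrite scale0r addr0 p0 horner0 => ->.
  have q0 : q != 0.
    apply: contraNneq gb => q0.
    by have := hq 1; rewrite scale1r addrC subrK q0 horner0 => ->.
  have [|t ht] := @poly_int_nonroot (p * q); first by rewrite mulf_neq0.
  by exists (a + t *: (b - a)); rewrite hp hq -hornerM.
- by move=> s; rewrite mulf_eq0 negb_or => /andP[/fB ? /gB].
Qed.

Lemma generically_all (d : nat) (l : seq 'rV[int]_d)
    (B : 'rV[int]_d -> 'rV[int]_d -> Prop) :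
  (forall x, x \in l -> generically (B x)) ->
  generically (fun s => forall x, x \in l -> B x s).
Proof.
elim: l => [_|x l IH hB]; first exact: generically_true.
have hx : generically (B x) by apply: hB; rewrite inE eqxx.
have hl : generically (fun s => forall x, x \in l -> B x s).
  by apply: IH => y yl; apply: hB; rewrite inE yl orbT.
apply: generically_sub (generically_and hx hl) => s [Bx Bl] y.
by rewrite inE => /predU1P[->|/Bl].
Qed.

(** The product list of the next stage depends on [s] itself. This splits a condition on its members
    into the old elements and the new products [m p s]. *)
Lemma generically_all_cat (d : nat) (m : 'rV[int]_d -> 'rV[int]_d -> 'rV[int]_d)
    (l P : seq 'rV[int]_d) (B : 'rV[int]_d -> 'rV[int]_d -> Prop) :
  (forall x, x \in l -> generically (B x)) ->
  (forall p, p \in P -> generically (fun s => B (m p s) s)) ->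
  generically (fun s => forall x, x \in l ++ [seq m p s | p <- P] -> B x s).
Proof.
move=> /generically_all hl.
move=> /(@generically_all d P (fun p s => B (m p s) s)) hP.
apply: generically_sub (generically_and hl hP) => s [Bl BP] y.
by rewrite mem_cat => /orP[/Bl//|/mapP[p pP ->]]; exact: BP.
Qed.

(** * Bilinearity of proper multiplications and a multiple of the unit *)

Lemma scalez_inj (d : nat) (n : int) :
  n != 0 -> injective (fun v : 'rV[int]_d => n *: v).
Proof.
move=> n0 v w /rowP eq; apply/rowP => j; move: (eq j).
by rewrite !mxE; apply: mulfI.
Qed.

Lemma scalez_eq0 (d : nat) (n : int) (v : 'rV[int]_d) :
  n != 0 -> (n *: v == 0) = (v == 0).
Proof. by move=> n0; rewrite -(inj_eq (scalez_inj n0) v 0) scaler0. Qed.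

Lemma additive_scalez (d : nat) (f : 'rV[int]_d -> 'rV[int]_d) :
  {morph f : x y / x + y} -> forall (n : int) x, f (n *: x) = n *: f x.
Proof.
move=> fD n x.
have f0 : f 0 = 0 by apply: (addrI (f 0)); rewrite -fD !addr0.
have fN y : f (- y) = - f y by apply: (addrI (f y)); rewrite -fD !subrr.
have fMn y k : f (y *+ k) = f y *+ k.
  by elim: k => [|k IH]; rewrite ?mulr0n // !mulrS fD IH.
rewrite -(intz n) !scaler_int; case: n => k; first by rewrite -!pmulrn fMn.
by rewrite NegzE !mulrNz fN -!pmulrn fMn.
Qed.

Lemma proper_mulZl (d : nat) (m : 'rV[int]_d -> 'rV[int]_d -> 'rV[int]_d) :
  proper_mul m -> forall (n : int) x y, m (n *: x) y = n *: m x y.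
Proof.
move=> [_ mDl _ _] n x y.
by apply: (@additive_scalez d (m^~ y)) => u v; rewrite mDl.
Qed.

Lemma proper_mulZr (d : nat) (m : 'rV[int]_d -> 'rV[int]_d -> 'rV[int]_d) :
  proper_mul m -> forall (n : int) x y, m x (n *: y) = n *: m x y.
Proof.
move=> [_ _ mDr _] n x y.
by apply: (@additive_scalez d (m x)) => u v; rewrite mDr.
Qed.

Lemma proper_mul0l (d : nat) (m : 'rV[int]_d -> 'rV[int]_d -> 'rV[int]_d) :
  proper_mul m -> forall x, m 0 x = 0.
Proof. by move=> hm x; have := proper_mulZl hm 0 0 x; rewrite !scale0r. Qed.

Lemma proper_mul0r (d : nat) (m : 'rV[int]_d -> 'rV[int]_d -> 'rV[int]_d) :
  proper_mul m -> forall x, m x 0 = 0.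
Proof. by move=> hm x; have := proper_mulZr hm 0 x 0; rewrite !scale0r. Qed.

Lemma proper_mul_neq0 (d : nat) (m : 'rV[int]_d -> 'rV[int]_d -> 'rV[int]_d) :
  proper_mul m -> forall x y, x != 0 -> y != 0 -> m x y != 0.
Proof.
by move=> [_ _ _ nzd] x y x0 y0; apply/eqP => /nzd[]; apply/eqP.
Qed.

Lemma proper_mul_sumr (d : nat) (m : 'rV[int]_d -> 'rV[int]_d -> 'rV[int]_d) :
  proper_mul m ->
  forall x y, m x y = \sum_l y 0 l *: m x (delta_mx 0 l).
Proof.
move=> hm x y; rewrite {1}(row_sum_delta y).
rewrite (big_morph (m x) (id1 := 0) (op1 := +%R)).
- by apply: eq_bigr => l _; rewrite proper_mulZr.
- by move=> u v; case: hm => _ _ ->.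
- exact: proper_mul0r.
Qed.

Lemma proper_mul_op (d : nat) (m : 'rV[int]_d -> 'rV[int]_d -> 'rV[int]_d) :
  proper_mul m -> proper_mul (op_mul m).
Proof.
move=> [mA mDl mDr nzd]; rewrite /op_mul; split.
- by move=> x y z; rewrite mA.
- by move=> x y z; rewrite mDr.
- by move=> x y z; rewrite mDl.
- by move=> x y /nzd[]; [right | left].
Qed.

(** Expansion in structure constants; it makes products of polynomial maps polynomial. *)
Lemma proper_mul_coord (d : nat) (m : 'rV[int]_d -> 'rV[int]_d -> 'rV[int]_d) :
  proper_mul m -> forall x y j,
  m x y 0 j =
    \sum_l \sum_k y 0 l * (x 0 k * m (delta_mx 0 k) (delta_mx 0 l) 0 j).
Proof.
move=> hm x y j; rewrite proper_mul_sumr // summxE; apply: eq_bigr => l _.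
have /= := proper_mul_sumr (proper_mul_op hm) (delta_mx 0 l) x.
rewrite /op_mul => ->; rewrite mxE summxE mulr_sumr.
by apply: eq_bigr => k _; rewrite mxE.
Qed.

(* The adjugate of the matrix of left multiplication by x supplies e with
   x e = (det) x; cancelling x makes e a multiple of the unit of the rational
   algebra spanned by the ring. *)
Lemma proper_mul_scaled_unit (d : nat)
    (m : 'rV[int]_d -> 'rV[int]_d -> 'rV[int]_d) (x : 'rV[int]_d) :
  proper_mul m -> x != 0 ->
  exists (N : int) (e : 'rV[int]_d),
    [/\ N != 0, forall y, m e y = N *: y & forall y, m y e = N *: y].
Proof.
move=> hm x0; have [mA mDl mDr nzd] := hm.
have cancel a b c : a != 0 -> m a b = m a c -> b = c.
  move=> a0 eq; have : m a (b + (- 1) *: c) = 0.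
    by rewrite mDr proper_mulZr // scaleN1r eq subrr.
  by case/nzd => [/eqP|/eqP]; rewrite ?(negPf a0) // scaleN1r subr_eq0 => /eqP.
pose A : 'M[int]_d := \matrix_k m x (delta_mx 0 k).
have AE y : m x y = y *m A.
  rewrite proper_mul_sumr // mulmx_sum_row.
  by apply: eq_bigr => k _; rewrite rowK.
have N0 : \det A != 0.
  apply/det0P => -[v v0]; rewrite -AE => /nzd[] /eqP; first by rewrite (negPf x0).
  by rewrite (negPf v0).
have xe : m x (x *m \adj A) = \det A *: x.
  by rewrite AE -mulmxA mul_adj_mx mul_mx_scalar.
have eL y : m (x *m \adj A) y = \det A *: y.
  by apply: (cancel x) => //; rewrite mA xe proper_mulZl // proper_mulZr.
exists (\det A), (x *m \adj A); split=> // y.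
have : m (m y (x *m \adj A) + (- \det A) *: y) x = 0.
  by rewrite mDl -mA eL (proper_mulZr hm) (proper_mulZl hm) scaleNr subrr.
by case/nzd => /eqP; rewrite ?(negPf x0) // scaleNr subr_eq0 => /eqP.
Qed.

(** * Homogeneous maps and comparison of degrees *)

(* Homogeneity is only recorded for the scaling s |-> 2 s, which is enough to
   tell degrees apart. *)
Definition homog_poly_map (d k : nat) (F : 'rV[int]_d -> 'rV[int]_d) : Prop :=
  (forall j, line_poly (fun s => F s 0 j)) /\
  (forall s, F (2 *: s) = 2 ^+ k *: F s).

Lemma homog_cst (d : nat) (c : 'rV[int]_d) : homog_poly_map 0 (fun=> c).
Proof. by split=> [j|s]; [exact: line_poly_cst | rewrite expr0 scale1r]. Qed.

Lemma homog_id (d : nat) : homog_poly_map 1 (fun s : 'rV[int]_d => s).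
Proof. by split=> [j|s]; [exact: line_poly_coord | rewrite expr1]. Qed.

Lemma homogZ (d k : nat) (n : int) (F : 'rV[int]_d -> 'rV[int]_d) :
  homog_poly_map k F -> homog_poly_map k (fun s => n *: F s).
Proof.
move=> [lF hF]; split=> [j|s]; last by rewrite hF !scalerA mulrC.
rewrite (_ : (fun s => _) = fun s => n * F s 0 j).
  exact: line_polyM (line_poly_cst n) (lF j).
by apply: funext => s; rewrite mxE.
Qed.

Lemma homog_mul (d i j : nat) (m : 'rV[int]_d -> 'rV[int]_d -> 'rV[int]_d)
    (F G : 'rV[int]_d -> 'rV[int]_d) :
  proper_mul m -> homog_poly_map i F -> homog_poly_map j G ->
  homog_poly_map (i + j) (fun s => m (F s) (G s)).
Proof.
move=> hm [lF hF] [lG hG]; split=> [c|s]; last first.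
  by rewrite hF hG proper_mulZl // proper_mulZr // scalerA exprD.
rewrite (funext (fun s => proper_mul_coord hm (F s) (G s) c)).
apply: line_poly_sum => l; apply: line_poly_sum => k.
exact: line_polyM (lG l) (line_polyM (lF k) (line_poly_cst _)).
Qed.

Lemma generically_neq (d i j : nat) (F G : 'rV[int]_d -> 'rV[int]_d) :
  homog_poly_map i F -> homog_poly_map j G -> (exists s, F s != G s) ->
  generically (fun s => F s != G s).
Proof.
move=> [lF _] [lG _] [s ne].
have [c hc] : exists c, F s 0 c - G s 0 c != 0.
  apply: contrapT => /forallNP h; move/eqP: ne; apply.
  by apply/rowP => c; apply/eqP; rewrite -subr_eq0; apply/negPn/negP/h.
exists (fun s => F s 0 c + (- 1) * G s 0 c); split.
- exact: line_polyD (lF c) (line_polyM (line_poly_cst _) (lG c)).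
- by exists s; rewrite mulN1r.
- move=> t; apply: contraNneq => ->.
  by rewrite mulN1r subrr.
Qed.

(** If both maps take the value v != 0 at [s], then at [2 *: s] they take the values 2^i v and 2^j
    v, which differ. *)
Lemma generically_neq_degree (d i j : nat) (F G : 'rV[int]_d -> 'rV[int]_d) :
  homog_poly_map i F -> homog_poly_map j G -> i != j -> (exists s, F s != 0) ->
  generically (fun s => F s != G s).
Proof.
move=> hF hG ij [s Fs]; apply: (generically_neq hF hG).
have [eq1|] := eqVneq (F s) (G s); last by exists s.
exists (2 *: s); rewrite hF.2 hG.2 -eq1 -subr_eq0 -scalerBl.
by rewrite scalez_eq0 // subr_eq0 (inj_eq (ieexprIn _ _)).
Qed.

(** Reads the degree in [s] off the syntax of the map, filling in the degree left open by [eapply].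
    The last branch undoes eta-reduction. *)
Ltac homog_tac hm ho :=
  lazymatch goal with
  | |- homog_poly_map _ (fun s => s) => exact: homog_id
  | |- homog_poly_map _ (fun _ => ?c) => exact: homog_cst
  | |- homog_poly_map _ (fun s => _ *: (@?G s)) =>
      refine (@homogZ _ _ _ G _); homog_tac hm ho
  | |- homog_poly_map _ (fun s => ?f (@?F s) (@?G s)) =>
      refine (@homog_mul _ _ _ f F G _ _ _);
      [first [exact: hm | exact: ho] | homog_tac hm ho | homog_tac hm ho]
  | |- homog_poly_map _ (?f ?p) =>
      change (f p) with (fun s => f p s); homog_tac hm ho
  end.

Ltac generic_neq_tac hm ho :=
  eapply generically_neq; [homog_tac hm ho | homog_tac hm ho | ].

Ltac generic_degree_tac hm ho :=
  eapply generically_neq_degree; [homog_tac hm ho | homog_tac hm ho | by [] | ].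

(** * The invariant of the greedy construction *)

(* P is N times the set of products of the chosen elements, the empty product
   being represented by e = N 1; C consists of the nonempty ones.  The two
   conditions say that the relations o (p x) y = r x (over P, C, P) and
   o (p x) (q t) = r t x are not identities, with denominators cleared. *)
Definition no_identities (d : nat)
    (m o : 'rV[int]_d -> 'rV[int]_d -> 'rV[int]_d) (N : int)
    (C P : seq 'rV[int]_d) : Prop :=
  (forall p, p \in P -> forall y, y \in C -> forall r, r \in P ->
    exists x, o (m p x) y != N *: m r x) /\
  (forall p, p \in P -> forall q, q \in P -> forall r, r \in P ->
    exists x t, o (m p x) (m q t) != N *: m (m r t) x).

(** Each of the three list elements is old or of the form [m p s], giving eight cases per condition.
    When the degrees in [s] differ, the other variables can be set to [e], any nonzero vector being
    good enough. When they agree, an old witness persists. *)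
Lemma generically_no_identities (d : nat)
    (m o : 'rV[int]_d -> 'rV[int]_d -> 'rV[int]_d) (N : int) (e : 'rV[int]_d)
    (C P : seq 'rV[int]_d) :
  proper_mul m -> proper_mul o ->
  N != 0 -> e != 0 -> (forall y, m y e = N *: y) ->
  (forall p, p \in P -> p != 0) -> {subset C <= P} ->
  no_identities m o N C P ->
  generically (fun s => no_identities m o N
    (C ++ [seq m p s | p <- P]) (P ++ [seq m p s | p <- P])).
Proof.
move=> hm ho N0 e0 eR P0 CP [hC hP].
have m0 := proper_mul_neq0 hm; have o0 := proper_mul_neq0 ho.
have nz x : x \in P -> m x e != 0 by move=> /P0 x0; apply: m0.
have NZl x y : o (N *: x) y = N *: o x y := proper_mulZl ho N x y.
have NZr x y : o x (N *: y) = N *: o x y := proper_mulZr ho N x y.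
have mZl x y : m (N *: x) y = N *: m x y := proper_mulZl hm N x y.
apply: generically_and.
- apply: generically_all_cat => p pP; apply: generically_all_cat => y yP;
    apply: generically_all_cat => r rP /=.
  + by apply: generically_true => s; apply: hC.
  + apply: (@generically_sub _ (fun s => o (m p e) y != N *: m (m r s) e)).
      by move=> s ?; exists e.
    by generic_degree_tac hm ho; exists e; apply: o0; auto.
  + apply: (@generically_sub _ (fun s => o (m p e) (m y s) != N *: m r e)).
      by move=> s ?; exists e.
    by generic_degree_tac hm ho; exists e; apply: o0; auto.
  (* With [y] and [r] both new, [s] takes the place of [t] in the second condition. *)
  + have [x [t ne]] := hP p pP y yP r rP.
    apply: (@generically_sub _ (fun s => o (m p x) (m y s) != N *: m (m r s) x)).
      by move=> s ?; exists x.
    by generic_neq_tac hm ho; exists t.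
  + apply: (@generically_sub _ (fun s => o (m (m p s) e) y != N *: m r e)).
      by move=> s ?; exists e.
    by generic_degree_tac hm ho; exists e; apply: o0; auto.
  + have [x ne] := hC p pP y yP r rP.
    apply: (@generically_sub _ (fun s => o (m (m p s) x) y != N *: m (m r s) x)).
      by move=> s ?; exists x.
    (* At [s = e] both sides become N times those of the old relation. *)
    generic_neq_tac hm ho; exists e.
    by rewrite !eR !mZl NZl (inj_eq (scalez_inj N0)).
  + apply: (@generically_sub _ (fun s => o (m (m p s) e) (m y s) != N *: m r e)).
      by move=> s ?; exists e.
    by generic_degree_tac hm ho; exists e; apply: o0; auto.
  + apply: (@generically_sub _
      (fun s => o (m (m p s) e) (m y s) != N *: m (m r s) e)).
      by move=> s ?; exists e.
    by generic_degree_tac hm ho; exists e; apply: o0; auto.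
- apply: generically_all_cat => p pP; apply: generically_all_cat => q qP;
    apply: generically_all_cat => r rP /=.
  + by apply: generically_true => s; apply: hP.
  + apply: (@generically_sub _
      (fun s => o (m p e) (m q e) != N *: m (m (m r s) e) e)).
      by move=> s ?; exists e, e.
    by generic_degree_tac hm ho; exists e; apply: o0; auto.
  + apply: (@generically_sub _
      (fun s => o (m p e) (m (m q s) e) != N *: m (m r e) e)).
      by move=> s ?; exists e, e.
    by generic_degree_tac hm ho; exists e; apply: o0; auto.
  + have [x [t ne]] := hP p pP q qP r rP.
    apply: (@generically_sub _
      (fun s => o (m p x) (m (m q s) t) != N *: m (m (m r s) t) x)).
      by move=> s ?; exists x, t.
    generic_neq_tac hm ho; exists e.
    by rewrite !eR !mZl NZr (inj_eq (scalez_inj N0)).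
  + apply: (@generically_sub _
      (fun s => o (m (m p s) e) (m q e) != N *: m (m r e) e)).
      by move=> s ?; exists e, e.
    by generic_degree_tac hm ho; exists e; apply: o0; auto.
  + have [x [t ne]] := hP p pP q qP r rP.
    apply: (@generically_sub _
      (fun s => o (m (m p s) x) (m q t) != N *: m (m (m r s) t) x)).
      by move=> s ?; exists x, t.
    generic_neq_tac hm ho; exists e.
    by rewrite !eR !mZl NZl (inj_eq (scalez_inj N0)).
  + apply: (@generically_sub _
      (fun s => o (m (m p s) e) (m (m q s) e) != N *: m (m r e) e)).
      by move=> s ?; exists e, e.
    by generic_degree_tac hm ho; exists e; apply: o0; auto.
  + apply: (@generically_sub _
      (fun s => o (m (m p s) e) (m (m q s) e) != N *: m (m (m r s) e) e)).
      by move=> s ?; exists e, e.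
    by generic_degree_tac hm ho; exists e; apply: o0; auto.
Qed.

(** For x = N a, y = N b, z = N c the second clause says that [m2 a b] differs from c, both sides
    being multiplied by N^2. The last clause covers relations with the new element in the right
    factor of [m2]. *)
Definition free_stage (d : nat)
    (m1 m2 : 'rV[int]_d -> 'rV[int]_d -> 'rV[int]_d) (N : int)
    (C P : seq 'rV[int]_d) : Prop :=
  [/\ forall p, p \in P -> p != 0,
      forall x, x \in C -> forall y, y \in C -> forall z, z \in P ->
        m2 x y != N *: z,
      no_identities m1 m2 N C P &
      no_identities m1 (op_mul m2) N C P].

(** In [m2 x y != N *: z] the degrees in [s] agree, apart from the all-old case, only if [z] and
    exactly one of [x], [y] are new. Those two cases are what the first halves of the
    [no_identities] clauses rule out as identities. *)
Lemma generically_free_stage (d : nat)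
    (m1 m2 : 'rV[int]_d -> 'rV[int]_d -> 'rV[int]_d) (N : int) (e : 'rV[int]_d)
    (C P : seq 'rV[int]_d) :
  proper_mul m1 -> proper_mul m2 ->
  N != 0 -> e != 0 -> (forall y, m1 y e = N *: y) -> {subset C <= P} ->
  free_stage m1 m2 N C P ->
  generically (fun s => free_stage m1 m2 N
    (C ++ [seq m1 p s | p <- P]) (P ++ [seq m1 p s | p <- P])).
Proof.
move=> h1 h2 N0 e0 eR CP [P0 hC hl hr].
have m0 := proper_mul_neq0 h1; have o0 := proper_mul_neq0 h2.
have gP0 : generically (fun s => forall p, p \in P ++ [seq m1 p s | p <- P] ->
    p != 0).
  apply: generically_all_cat => p pP /=.
    by apply: generically_true => s; apply: P0.
  by generic_degree_tac h1 h2; exists e; auto.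
have gl := generically_no_identities h1 h2 N0 e0 eR P0 CP hl.
have gr := generically_no_identities h1 (proper_mul_op h2) N0 e0 eR P0 CP hr.
have gC : generically (fun s =>
    forall x, x \in C ++ [seq m1 p s | p <- P] ->
    forall y, y \in C ++ [seq m1 p s | p <- P] ->
    forall z, z \in P ++ [seq m1 p s | p <- P] -> m2 x y != N *: z).
  apply: generically_all_cat => x xP; apply: generically_all_cat => y yP;
    apply: generically_all_cat => z zP /=.
  - by apply: generically_true => s; apply: hC.
  - by generic_degree_tac h1 h2; exists e; auto.
  - by generic_degree_tac h1 h2; exists e; auto.
  - by generic_neq_tac h1 h2; apply: hr.1.
  - by generic_degree_tac h1 h2; exists e; auto.
  - by generic_neq_tac h1 h2; apply: hl.1.
  - by generic_degree_tac h1 h2; exists e; auto.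
  - by generic_degree_tac h1 h2; exists e; auto.
apply: generically_sub (generically_and (generically_and gP0 gC)
  (generically_and gl gr)).
by move=> s [[? ?] [? ?]].
Qed.

(** With [C] empty only the conditions on p = q = r = e remain. Since [e] acts as N on the left,
    they reduce to [m2 x t != m1 t x] and [m2 t x != m1 t x] for some [x], [t]. *)
Lemma free_stage0 (d : nat)
    (m1 m2 : 'rV[int]_d -> 'rV[int]_d -> 'rV[int]_d) (N : int)
    (e : 'rV[int]_d) :
  proper_mul m1 -> proper_mul m2 -> N != 0 -> e != 0 ->
  (forall y, m1 e y = N *: y) -> m2 <> m1 -> m2 <> op_mul m1 ->
  free_stage m1 m2 N [::] [:: e].
Proof.
move=> h1 h2 N0 e0 eL ne neop.
have ex (f g : 'rV[int]_d -> 'rV[int]_d -> 'rV[int]_d) :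
    f <> g -> exists x y, f x y != g x y.
  move=> fg; apply: contrapT => h; apply: fg.
  apply: funext => x; apply: funext => y; apply: contrapT => /eqP ?.
  by apply: h; exists x, y.
split=> //.
- by move=> p; rewrite inE => /eqP->.
- split=> // p; rewrite inE => /eqP-> q; rewrite inE => /eqP-> r.
  rewrite inE => /eqP->; have [x [t xt]] := ex _ _ neop; exists x, t.
  rewrite !eL (proper_mulZl h1) (proper_mulZl h2) (proper_mulZr h2).
  by rewrite !(inj_eq (scalez_inj N0)).
- split=> // p; rewrite inE => /eqP-> q; rewrite inE => /eqP-> r.
  rewrite inE => /eqP->; have [t [x xt]] := ex _ _ ne; exists x, t.
  rewrite /op_mul !eL (proper_mulZl h1) (proper_mulZl h2) (proper_mulZr h2).
  by rewrite !(inj_eq (scalez_inj N0)).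
Qed.

(** * The greedy sequence and its products *)

Lemma exists_free_sequence (d : nat)
    (m1 m2 : 'rV[int]_d -> 'rV[int]_d -> 'rV[int]_d) (N : int)
    (e : 'rV[int]_d) :
  proper_mul m1 -> proper_mul m2 -> N != 0 -> e != 0 ->
  (forall y, m1 e y = N *: y) -> (forall y, m1 y e = N *: y) ->
  m2 <> m1 -> m2 <> op_mul m1 ->
  exists (s : nat -> 'rV[int]_d) (C : nat -> seq 'rV[int]_d),
    [/\ forall n, C n.+1 = C n ++ [seq m1 p (s n) | p <- e :: C n] &
        forall n, free_stage m1 m2 N (C n) (e :: C n)].
Proof.
move=> h1 h2 N0 e0 eL eR ne neop.
(* The invariant travels with the list, so that the choice function for the next element can be
   iterated. *)
pose stage := {C | free_stage m1 m2 N C (e :: C)}.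
pose next (C : seq 'rV[int]_d) s := C ++ [seq m1 p s | p <- e :: C].
have step (C : stage) :
    exists s, free_stage m1 m2 N (next (sval C) s) (e :: next (sval C) s).
  case: C => C hC; apply: generically_ex.
  apply: (generically_free_stage h1 h2 N0 e0 eR _ hC).
  by move=> x xC; rewrite inE xC orbT.
have [f hf] := choice step.
pose st := fix st n : stage :=
  if n is k.+1 then exist _ (next (sval (st k)) (f (st k))) (hf (st k))
  else exist _ [::] (free_stage0 h1 h2 N0 e0 eL ne neop).
exists (fun n => f (st n)), (fun n => sval (st n)); split=> // n.
exact: (svalP (st n)).
Qed.

(** Induction on the stage, looking at the last index: if it is n, the product is new at this step,
    its possibly empty prefix being [e] or a member of [C n]; otherwise all indices are below n. *)
Lemma foldl_mem_stage (T : eqType) (m : T -> T -> T) (e : T) (s : nat -> T)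
    (C : nat -> seq T) :
  (forall n, C n.+1 = C n ++ [seq m p (s n) | p <- e :: C n]) ->
  forall n l, sorted ltn l -> all (gtn n) l -> l != [::] ->
  foldl m e (map s l) \in C n.
Proof.
move=> hC; elim=> [|n IH] l; first by case: l.
case/lastP: l => [//|l j] srt; rewrite all_rcons => /andP[/= jn _] _.
move: (srt); rewrite sorted_pairwise; last exact: ltn_trans.
rewrite pairwise_rcons -sorted_pairwise; last exact: ltn_trans.
move=> /andP[lj srt_l].
rewrite map_rcons foldl_rcons hC mem_cat.
move: jn; rewrite ltnS leq_eqVlt => /predU1P[jn|jn]; apply/orP.
- subst j; right; apply/mapP; exists (foldl m e (map s l)) => //.
  rewrite inE; have [->|l0] := eqVneq l [::].
    by rewrite eqxx.
  by rewrite IH ?orbT.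
- left; rewrite -foldl_rcons -map_rcons; apply: IH => //.
    by rewrite all_rcons /= jn /=; apply: sub_all lj => i /= /ltn_trans; apply.
  by case: (l).
Qed.

(** * The IP set of products of the free sequence *)

Theorem theorem6p1 (d : nat)
    (mul1 mul2 : 'rV[int]_d -> 'rV[int]_d -> 'rV[int]_d)
    (hmul1 : proper_mul mul1) (hmul2 : proper_mul mul2)
    (hneq : mul2 <> mul1) (hneq_op : mul2 <> op_mul mul1) :
  exists A : set 'rV[int]_d,
    [/\ A `<=` nonzero_vec d,
        is_IP (nonzero_vec d) mul1 A &
        ~ is_IPr 2 (nonzero_vec d) mul2 A].
Proof.
(* In the zero module any two multiplications coincide. *)
have [x x0] : exists x : 'rV[int]_d, x != 0.
  apply: contrapT => h; apply: hneq.
  have all0 (v : 'rV[int]_d) : v = 0.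
    by apply: contrapT => /eqP ?; apply: h; exists v.
  by apply: funext => u; apply: funext => v; rewrite [LHS]all0 [RHS]all0.
have [N [e [N0 eL eR]]] := proper_mul_scaled_unit hmul1 x0.
have e0 : e != 0.
  apply/eqP => e0; have := eL x; rewrite e0 proper_mul0l // => /esym/eqP.
  by rewrite scalez_eq0 // (negPf x0).
have [s [C [hC hfree]]] :=
  exists_free_sequence hmul1 hmul2 N0 e0 eL eR hneq hneq_op.
pose A := ordered_products ltn mul1 s.
(* Membership holds at all late stages, so that several elements of [A] can be compared at one
   stage. *)
have inC a : A a -> exists n0, forall n, (n0 <= n)%N -> N *: a \in C n.
  move=> [i [l [il ->]]]; exists (\max_(k <- i :: l) k).+1 => n hn.
  (* Starting the fold at [e] contributes exactly the factor N. *)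
  have -> : N *: foldl mul1 (s i) (map s l) = foldl mul1 e (map s (i :: l)).
    rewrite /= eL; elim: (l) (s i) => [//|k k' IH] y /=.
    by rewrite IH (proper_mulZl hmul1).
  apply: (foldl_mem_stage hC) => //; apply/allP => k kl.
  by apply: leq_trans hn; rewrite /= ltnS; apply: leq_bigmax_seq.
have A0 a : A a -> a <> 0.
  move=> /inC[n /(_ n (leqnn n)) aC] a0.
  have [P0 _ _ _] := hfree n; move: (P0 (N *: a)).
  by rewrite inE aC orbT a0 scaler0 eqxx => /(_ isT).
exists A; split=> //.
- by exists s; split=> // i; apply: A0; exists i, [::].
(* The two generators and their [mul2] product would all lie in [A]; at a common stage this
   contradicts the second clause of [free_stage]. *)
- move=> [t [_ tA]].
  have [|n1 h1] := inC (t ord0); first by apply: tA; exists ord0, [::].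
  have [|n2 h2] := inC (t ord_max); first by apply: tA; exists ord_max, [::].
  have [|n3 h3] := inC (mul2 (t ord0) (t ord_max)).
    by apply: tA; exists ord0, [:: ord_max].
  pose n := (n1 + n2 + n3)%N.
  have [_ hb _ _] := hfree n.
  have n1n : (n1 <= n)%N by rewrite /n -addnA leq_addr.
  have n2n : (n2 <= n)%N by rewrite /n addnAC leq_addl.
  have n3n : N *: mul2 (t ord0) (t ord_max) \in e :: C n.
    by rewrite inE h3 ?orbT // leq_addl.
  have := hb _ (h1 n n1n) _ (h2 n n2n) _ n3n.
  by rewrite (proper_mulZl hmul2) (proper_mulZr hmul2) eqxx.
Qed.
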